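(* Let $n\geq1$, let $C_n\subset\hat A^n$ be an arbitrary finite nonempty set, and suppose $D=E_{P_n}[\rho_n(X_1^n,C_n)]$ is finite. Then $$\log M^n(C_n)\geq R_n(D).$$ If $\mathbb P$ is a stationary measure, then for all $n\ge1$, $\log M^n(C_n)\geq nR(D)$.
   Context: General setting: $A$ and $\hat A$ are Polish spaces with Borel $\sigma$-algebras ${\cal A},\hat{\cal A}$; $\mathbb P$ is a probability measure on $(A^{\mathbb N},{\cal A}^{\mathbb N})$, $\{X_n\}$ is a process with law $\mathbb P$, and $P_n$ is the law of $X_1^n=(X_1,\dots,X_n)$. $\mathbb P$ is stationary if $X_1^n$ and $X_{1+k}^{n+k}$ have the same law for all $n,k$. $\rho:A\times\hat A\to[0,\infty)$ is measurable and $\rho_n(x_1^n,y_1^n)=\frac1n\sum_{i=1}^n\rho(x_i,y_i)$; $\rho_n(x_1^n,C)=\min_{y_1^n\in C}\rho_n(x_1^n,y_1^n)$ for finite $C$. $M:\hat A\to(0,\infty)$ is measurable with $M(y)\ge M_*$ for a constant $M_*>0$; $M^n(y_1^n)=\prod_iM(y_i)$ and $M^n(C)=\sum_{y_1^n\in C}M^n(y_1^n)$. Relative entropy: $H(\mu\|\nu)=\int\log\frac{d\mu}{d\nu}\,d\mu$ if $\mu\ll\nu$, and $+\infty$ otherwise. For a probability measure $Q_n$ on $\hat A^n$, ${\cal M}_n(P_n,Q_n,D)$ is the set of probability measures $W_n$ on $A^n\times\hat A^n$ with first marginal $P_n$, second marginal $Q_n$, and $\int\rho_n\,dW_n\le D$;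 $I_n(P_n,Q_n,D)=\inf_{W_n\in{\cal M}_n(P_n,Q_n,D)}H(W_n\|P_n\times Q_n)$ ($+\infty$ if empty); $R_n(D)=\inf_{Q_n}\{I_n(P_n,Q_n,D)+E_{Q_n}[\log M^n(Y_1^n)]\}$ over all probability measures $Q_n$ on $\hat A^n$; $R(D)=\lim_{n\to\infty}\frac1nR_n(D)$ when the limit exists. Logarithms are natural. *)

(* Defs.v *)
From HB Require Import structures.
From mathcomp Require Import all_boot all_order all_algebra.
From mathcomp Require Import finmap.
From mathcomp Require Import all_classical all_reals all_analysis.
Import Order.TTheory GRing.Theory Num.Theory.

Set Implicit Arguments.
Unset Strict Implicit.
Unset Printing Implicit Defensive.

Local Open Scope classical_set_scope.
Local Open Scope ring_scope.

Section polish.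
Context (R : realType) (d : measure_display) (T : measurableType d).

Definition metric_open (dist : T -> T -> R) (U : set T) : Prop :=
  forall x, U x -> exists2 e : R, 0 < e & forall y, dist x y < e -> U y.

Definition is_metric (dist : T -> T -> R) : Prop :=
  [/\ forall x y, 0 <= dist x y,
      forall x y, dist x y = 0 <-> x = y,
      forall x y, dist x y = dist y x &
      forall x y z, dist x z <= dist x y + dist y z].

Definition metric_complete (dist : T -> T -> R) : Prop :=
  forall u : nat -> T,
    (forall e : R, 0 < e -> exists N, forall m k, (N <= m)%N -> (N <= k)%N ->
        dist (u m) (u k) < e) ->
    exists x, forall e : R, 0 < e -> exists N, forall m, (N <= m)%N ->
        dist (u m) x < e.

Definition metric_separable (dist : T -> T -> R) : Prop :=
  exists S : set T, countable S /\
    forall x (e : R), 0 < e -> exists2 s, S s & dist x s < e.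

Definition polish_borel : Prop :=
  exists dist : T -> T -> R,
    [/\ is_metric dist, metric_complete dist, metric_separable dist &
        @measurable _ T = <<s metric_open dist >>].
End polish.

(* Blocks of a process X : nat -> Omega -> A; X 0 plays the role of X_1 *)
(* block X k n = (X_{1+k}, ..., X_{n+k}).                               *)
Section block.
Context (dO dA : measure_display) (O : measurableType dO) (A : measurableType dA).
Variable X : nat -> {mfun O >-> A}.

Definition block (k n : nat) : O -> n.-tuple A :=
  fun w => [tuple X (k + val i) w | i < n].

Lemma measurable_block k n : measurable_fun [set: O] (block k n).
Proof.
apply/measurable_fun_tnthP => i.
rewrite /comp /block.
have -> : (fun x : O => tnth [tuple X (k + val j) x | j < n] i) = X (k + val i).
  by apply/funext => x; rewrite tnth_mktuple.
exact: measurable_funPT.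
Qed.

HB.instance Definition _ k n :=
  isMeasurableFun.Build _ _ _ _ (block k n) (@measurable_block k n).
End block.

Section blockfun.
Context (R : realType) (dA dB : measure_display)
        (A : measurableType dA) (B : measurableType dB).

Definition rhon (rho : A -> B -> R) (n : nat) (x : n.-tuple A) (y : n.-tuple B) : R :=
  n%:R^-1 * \sum_(i < n) rho (tnth x i) (tnth y i).

(* rho_n(x, C) = min_{y in C} rho_n(x, y), as an extended real
   (equal to the minimum when C is nonempty) *)
Definition rhonC (rho : A -> B -> R) (n : nat) (C : seq (n.-tuple B))
  (x : n.-tuple A) : \bar R :=
  \big[Order.min/+oo%E]_(y <- C) (rhon rho x y)%:E.

Definition Mn (M : B -> R) (n : nat) (y : n.-tuple B) : R :=
  \prod_(i < n) M (tnth y i).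

Definition MnC (M : B -> R) (n : nat) (C : {fset (n.-tuple B)}) : R :=
  \sum_(y <- C) Mn M y.
End blockfun.

Section relent.
Context (R : realType) (d : measure_display) (T : measurableType d).

Definition relent (mu : probability T R)
  (nu : probability T R) : \bar R :=
  if pselect (mu `<< nu) then
    (\int[mu]_x (ln (fine (Radon_Nikodym (charge_of_finite_measure mu) nu x)))%:E)%E
  else +oo%E.
End relent.

Section ratedist.
Context (R : realType) (dA dB : measure_display)
        (A : measurableType dA) (B : measurableType dB).
Variables (rho : A -> B -> R) (M : B -> R).

Definition couplings (n : nat) (P : probability (n.-tuple A) R)
  (Q : probability (n.-tuple B) R) (D : R)
  (W : probability (n.-tuple A * n.-tuple B)%type R) : Prop :=
  [/\ forall S, measurable S -> W (fst @^-1` S) = P S,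
      forall S, measurable S -> W (snd @^-1` S) = Q S &
      (\int[W]_z (rhon rho z.1 z.2)%:E <= D%:E)%E].

Definition In (n : nat) (P : probability (n.-tuple A) R)
  (Q : probability (n.-tuple B) R) (D : R) : \bar R :=
  ereal_inf [set relent W (P \x Q)%E | W in couplings P Q D].

Definition Rn (n : nat) (P : probability (n.-tuple A) R) (D : R) : \bar R :=
  ereal_inf [set x | exists Q : probability (n.-tuple B) R,
    x = (In P Q D + \int[Q]_y (ln (Mn M y))%:E)%E].
End ratedist.

(* Main.v *)
Require Import Defs.
From HB Require Import structures.
From mathcomp Require Import all_boot all_order all_algebra.
From mathcomp Require Import finmap.
From mathcomp Require Import all_classical all_reals all_analysis.
From mathcomp Require Import measurable_realfun.
Import Order.TTheory GRing.Theory Num.Theory.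

Local Open Scope classical_set_scope.
Local Open Scope ring_scope.

(* Let Y(x) be a codeword of C_n nearest to x, W the law of (X, Y(X)) and Q   *)
(* the law of Y(X).  Then W is an admissible coupling whose density with      *)
(* respect to P x Q is 1{y = Y(x)} / Q{y}, so that H(W || P x Q) is the       *)
(* Shannon entropy of Q, and Gibbs' inequality gives                          *)
(*   R_n(D) <= sum_y Q(y) (log M^n(y) - log Q(y)) <= log M^n(C_n).            *)
(* For a stationary source the product code C_n^k has the same distortion D   *)
(* and M^(kn)(C_n^k) = M^n(C_n)^k, so R_(kn)(D) <= k log M^n(C_n); divide by  *)
(* kn and let k go to infinity.                                               *)

(** A code bounds [Rn] from above because its quantizer is one competitor in the infimum. The output
    is a function of the source, so the relative entropy of the joint law is the Shannon entropy of
    the output ([relent_graph]), and entropy plus mean log-mass never exceeds the log of the total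
    mass ([gibbs]). [Rn_le_finite_range] joins the two for any quantizer with finite range. Both
    claims are instances of it: [Rn_le_code] for the nearest codeword, which
    [measurable_nearest_codeword] selects measurably, and [Rn_le_product_code] for the same
    quantizer applied block by block. *)

Lemma gibbs (R : realType) (I : finType) (p m : I -> R) :
  (forall i, 0 <= p i) -> \sum_i p i = 1 -> (forall i, 0 < m i) ->
  \sum_i p i * (ln (m i) - ln (p i)) <= ln (\sum_i m i).
Proof.
move=> p0 p1 m0; set S := \sum_i m i.
have S0 : 0 < S.
  have [i _] : exists i, 0 < p i.
    apply/existsP; apply: contra_eqT p1 => /existsPn p_le0.
    rewrite big1 ?(eq_sym 0) ?oner_neq0// => i _.
    by apply/eqP; rewrite eq_le p0 andbT leNgt p_le0.
  by rewrite /S (bigD1 i)//= ltr_pwDl ?sumr_ge0// => j _; exact: ltW.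
(* The weights sum to 1, so [ln S] moves inside the sum. Then [ln t <= t - 1] at [t = m i / S / p i]
   bounds each term by [m i / S - p i], and these bounds add up to 0. Where [p i = 0] the term is 0
   and its bound is nonnegative. *)
rewrite -subr_le0 -[ln S]mul1r -p1 mulr_suml -sumrB.
apply: (@le_trans _ _ (\sum_i (m i / S - p i))); last first.
  by rewrite sumrB -mulr_suml p1 divff ?subrr// gt_eqF.
apply: ler_sum => i _; have [pi0|pi0] := eqVneq (p i) 0.
  by rewrite pi0 !mul0r !subr0 divr_ge0// ltW.
have p_gt0 : 0 < p i by rewrite lt_neqAle eq_sym pi0 p0.
have -> : m i / S - p i = p i * (m i / S / p i - 1).
  by rewrite mulrBr mulr1 mulrCA divff ?mulr1// gt_eqF.
rewrite -mulrBr ler_pM2l//.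
have -> : ln (m i) - ln (p i) - ln S = ln (m i / S / p i).
  by rewrite !ln_div ?posrE ?divr_gt0// addrAC.
rewrite -[X in ln X](addrNK 1) addrC le_ln1Dx//.
by rewrite ltrBrDr addNr !divr_gt0.
Qed.

(** * Integrating functions of a finite-valued map *)

Section finite_valued.
Context {d1 : measure_display} {T1 : measurableType d1} {R : realType}.
Context (P : probability T1 R) {I : finType} (g : T1 -> I).
Hypothesis mg : forall i, measurable (g @^-1` [set i]).

(** [F \o g] is a linear combination of indicators of the fibres of [g]; [I] carries no
    sigma-algebra, so measurability of [g] is expressed by its fibres. *)
Lemma integrable_finite_valued (F : I -> R) :
  P.-integrable [set: T1] (fun x => (F (g x))%:E).
Proof.
have -> : (fun x => (F (g x))%:E) =
    (fun x => \sum_(i <- enum I) (F i * \1_(g @^-1` [set i]) x)%:E)%E.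
  apply/funext => x; rewrite sumEFin; congr EFin.
  rewrite big_enum/= (bigD1 (g x))//= big1 ?addr0 => [|i ig].
    by rewrite indicE mem_set ?mulr1.
  by rewrite indicE memNset ?mulr0// => /= gi; rewrite -gi eqxx in ig.
apply: integrable_sum => // i _.
apply: (@eq_integrable _ _ _ _ _ measurableT
  (fun x => (F i)%:E * (\1_(g @^-1` [set i]) x)%:E)%E) => //.
exact/integrableZl/integrable_indic.
Qed.

Lemma integral_finite_valued (F : I -> R) :
  (\int[P]_x (F (g x))%:E =
   (\sum_i fine (P (g @^-1` [set i])) * F i)%:E)%E.
Proof.
under eq_integral => x _.
  rewrite (_ : (F (g x))%:E =
    (\sum_(i <- enum I) (F i)%:E * (\1_(g @^-1` [set i]) x)%:E)%E); last first.
    rewrite big_enum/= (bigD1 (g x))//= big1 ?adde0 => [|i ig].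
      by rewrite indicE mem_set ?mule1.
    by rewrite indicE memNset ?mule0// => /= gi; rewrite -gi eqxx in ig.
  over.
rewrite integral_sum//= => [|i]; last exact/integrableZl/integrable_indic.
rewrite -sumEFin big_enum/=; apply: eq_bigr => i _.
rewrite integralZl//=; last exact/integrable_indic.
by rewrite integral_indic// setIT EFinM fineK ?fin_num_measure// muleC.
Qed.

Lemma sum_finite_valued : \sum_i fine (P (g @^-1` [set i])) = 1.
Proof.
have := integral_finite_valued (fun=> 1).
rewrite (integral_cst P measurableT).
rewrite [X in (1 * X)%E](probability_setT P) mule1 => -[->].
by apply: eq_bigr => i _; rewrite mulr1.
Qed.

Lemma measure_fibres (S : set T1) : measurable S ->
  (P S = \sum_i P (g @^-1` [set i] `&` S))%E.
Proof.
move=> mS; rewrite (fsbig_seq _ _ (index_enum_uniq I)) -measure_fin_bigcup//.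
- congr (P _); apply/seteqP; split=> [x Sx|x [i _ [_ //]]].
  by exists (g x) => //=; rewrite mem_index_enum.
- apply/trivIsetP => i j _ _ /eqP ij; rewrite -subset0.
  move=> x [[/= gi _] [/= gj _]].
  by apply: ij; rewrite -gi.
- by move=> i _; exact: measurableI.
Qed.

End finite_valued.

(** * Relative entropy of the law of a graph *)

Section graph.
Context {d1 d2 : measure_display}.
Context {T1 : measurableType d1} {T2 : measurableType d2}.

Definition graph (Y : T1 -> T2) (x : T1) : T1 * T2 := (x, Y x).

Lemma measurable_graph (Y : {mfun T1 >-> T2}) :
  measurable_fun [set: T1] (graph Y).
Proof. exact: measurable_fun_pair. Qed.

HB.instance Definition _ (Y : {mfun T1 >-> T2}) :=
  isMeasurableFun.Build _ _ _ _ (graph Y) (measurable_graph Y).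
End graph.

Section relent_graph.
Context {d1 d2 : measure_display}.
Context {T1 : measurableType d1} {T2 : measurableType d2}.
Context {R : realType} (P : probability T1 R) (Y : {mfun T1 >-> T2}).
Context {I : finType} (e : I -> T2) (g : T1 -> I).
Hypotheses (e_inj : injective e) (me : forall i, measurable [set e i]).
Hypothesis Yeg : forall x, Y x = e (g x).

Let p i := fine (P (g @^-1` [set i])).
Let Q := distribution P Y.
Let W := distribution P (graph Y).
(** The slabs are disjoint and cover the graph of [Y]; slab [i] has mass [p i] under [W] and [p i]
    squared under [P \x Q], whence the density [(p i)^-1]. *)
Let slab i := (g @^-1` [set i]) `*` [set e i].

Lemma fibreE i : g @^-1` [set i] = Y @^-1` [set e i].
Proof. by apply/seteqP; split => x /=; rewrite Yeg; [move=> ->|move/e_inj]. Qed.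

Lemma measurable_fibre i : measurable (g @^-1` [set i]).
Proof.
by rewrite fibreE -[X in measurable X]setTI; exact: measurable_funPT.
Qed.

Let measurable_slab i : measurable (slab i).
Proof. by apply: measurableX => //; exact: measurable_fibre. Qed.

(** On a slab the second coordinate is frozen at [e i], so the intersection with [E] is a rectangle
    over a section of [E], and [Q] gives its second side mass [p i]. *)
Let prod_slab E i : measurable E ->
  ((P \x Q) (slab i `&` E) =
   (p i)%:E * P (g @^-1` [set i] `&` graph Y @^-1` E))%E.
Proof.
move=> mE.
have -> : slab i `&` E = (g @^-1` [set i] `&` ysection E (e i)) `*` [set e i].
  apply/seteqP; split => -[x y] /=.
    by move=> [[/= gx yi]]; rewrite yi ysectionE.
  by rewrite ysectionE => -[[/= gx Exi] ->].
rewrite product_measure1E//; last first.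
  by apply: measurableI; [exact: measurable_fibre|exact: measurable_ysection].
rewrite muleC; congr (_ * _)%E.
  rewrite fineK ?fin_num_measure//; last exact: measurable_fibre.
  by rewrite fibreE.
congr (P _); apply/seteqP; split => x /=; rewrite ysectionE/= /graph Yeg.
  by move=> [-> ?].
by move=> [-> ?].
Qed.

(* With 0^-1 = 0 and ln 0 = 0, the indices of mass p i = 0 drop out. *)
Let density (z : T1 * T2) : R := \sum_(i <- enum I) (p i)^-1 * \1_(slab i) z.

Let p_ge0 i : 0 <= p i. Proof. exact: fine_ge0. Qed.

Let measurable_density :
  measurable_fun [set: T1 * T2] (fun z => (density z)%:E).
Proof.
apply/measurable_EFinP; apply: measurable_sum => i.
exact/measurable_funM.
Qed.

Let integral_density E : measurable E ->
  (\int[P \x Q]_(z in E) (density z)%:E = W E)%E.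
Proof.
move=> mE; under eq_integral do rewrite -sumEFin.
rewrite ge0_integral_sum//; last 2 first.
- move=> i; apply/measurable_EFinP; apply: measurable_funTS.
  exact/measurable_funM.
- by move=> i z _; rewrite lee_fin mulr_ge0// invr_ge0.
rewrite big_enum/=.
rewrite -[RHS]/(P (graph Y @^-1` E)).
rewrite (measure_fibres P g measurable_fibre); last first.
  by rewrite -[X in measurable X]setTI; exact: measurable_funPT.
apply: eq_bigr => i _.
under eq_integral do rewrite EFinM.
rewrite ge0_integralZl//; last 2 first.
- by apply/measurable_EFinP; apply: measurable_funTS.
- by rewrite lee_fin invr_ge0.
rewrite integral_indic// -[X in (_ * X)%E]/((P \x Q)%E (slab i `&` E)).
rewrite prod_slab//.
have [pi0|pi0] := eqVneq (p i) 0; last first.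
  by rewrite muleA -EFinM mulVf// mul1e.
(* The density contributes 0 here, and the other side is the measure of a subset of a null fibre. *)
rewrite pi0 mul0e mule0; apply/esym/eqP; rewrite eq_le measure_ge0 andbT.
apply: (@le_trans _ _ (P (g @^-1` [set i]))).
  apply: le_measure; rewrite ?inE.
  - apply: measurableI; first exact: measurable_fibre.
    by rewrite -[X in measurable X]setTI; exact: measurable_funPT.
  - exact: measurable_fibre.
  - by move=> x [].
rewrite -[leLHS]fineK ?fin_num_measure ?lee_fin -/(p i) ?pi0//.
exact: measurable_fibre.
Qed.

Let dominated : W `<< (P \x Q)%E.
Proof.
apply/null_content_dominatesP => E mE PQE0.
rewrite -integral_density// (ae_eq_integral (cst 0%E)) ?integral0//.
- exact: measurable_funTS.
- exact: ae_eq0.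
Qed.

(** Along the graph the density at [(x, Y x)] is [(p (g x))^-1], so the divergence is the mean of
    [- ln (p (g x))]. *)
Lemma relent_graph :
  relent W (P \x Q)%E = (- \sum_i p i * ln (p i))%:E.
Proof.
pose PQ : probability (T1 * T2)%type R := (P \x Q)%E.
(* The branch without absolute continuity contradicts [dominated]. *)
rewrite -/PQ /relent; case: pselect => // dom.
set f := Radon_Nikodym _ _.
(* The Radon-Nikodym derivative is determined only almost everywhere; it agrees with [density]
   because both have the same integral over every measurable set. *)
have fE : ae_eq PQ setT f (fun z => (density z)%:E).
  apply: integral_ae_eq => //.
  - exact: Radon_Nikodym_integrable.
  - move=> E _ mE; rewrite -Radon_Nikodym_integral//.
    exact/esym/integral_density.
have mf : measurable_fun setT f.
  by apply: measurable_int; exact: Radon_Nikodym_integrable.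
have mden : measurable_fun setT (fun z => (ln (density z))%:E).
  apply/measurable_EFinP; apply: measurableT_comp => //.
  exact/measurable_EFinP.
transitivity (\int[W]_z (ln (density z))%:E)%E.
  apply: ae_eq_integral => //.
    apply/measurable_EFinP; apply: measurableT_comp => //.
    exact: measurableT_comp.
  (* Equality holds off a [PQ]-null set, which is [W]-null by domination. *)
  apply: (null_dominates_ae_eq measurableT dom).
  by apply: filterS fE => z /= /(_ Logic.I) ->.
have denE x : ln (density (graph Y x)) = - ln (p (g x)).
  rewrite /density big_enum/= (bigD1 (g x))//= big1 ?addr0 => [|i ig].
    rewrite indicE mem_set ?mulr1; last by split => //=; rewrite Yeg.
    have [->|pgx] := eqVneq (p (g x)) 0; first by rewrite invr0 ln0// oppr0.
    by rewrite lnV// posrE lt_neqAle eq_sym pgx p_ge0.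
  by rewrite indicE memNset ?mulr0// => -[/= gi _]; rewrite -gi eqxx in ig.
have denE' : (fun z => (ln (density z))%:E) \o graph Y =
    (fun x => (- ln (p (g x)))%:E).
  by apply/funext => x /=; rewrite denE.
rewrite integral_distribution//; last first.
  rewrite denE'.
  exact: (integrable_finite_valued P g measurable_fibre (fun i => - ln (p i))).
rewrite denE'.
rewrite (integral_finite_valued P g measurable_fibre (fun i => - ln (p i))).
by rewrite -sumrN; congr EFin; apply: eq_bigr => i _; rewrite mulrN.
Qed.

End relent_graph.

(** * Measurability of points *)

(** The complement of [y] is open: around [x] the ball of radius [dist x y] misses [y]. *)
Lemma polish_measurable_set1 (R : realType) (d : measure_display)
  (T : measurableType d) (y : T) : polish_borel R T -> measurable [set y].
Proof.
move=> [dist [[dist_ge0 dist_eq0 _ _] _ _ mT]].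
rewrite -(setCK [set y]); apply: measurableC; rewrite mT.
apply: sub_sigma_algebra => x /= xy; exists (dist x y).
  rewrite lt_neqAle dist_ge0 andbT.
  by apply: contra_not_neq xy => /esym/dist_eq0.
by move=> z xz zy; rewrite zy ltxx in xz.
Qed.

Lemma measurable_tuple_set1 (d : measure_display) (T : measurableType d)
  (n : nat) (y : n.-tuple T) :
  (forall t : T, measurable [set t]) -> measurable [set y].
Proof.
move=> mT.
have -> : [set y] =
    \bigcap_(i in [set: 'I_n]) ((@tnth n T)^~ i @^-1` [set tnth y i]).
  apply/seteqP; split=> [x -> i //|x xy].
  by apply: eq_from_tnth => i; exact: xy.
apply: fin_bigcap_measurable => // i _.
by rewrite -[X in measurable X]setTI; exact: measurable_tnth.
Qed.

(** * Cutting a word of length [k * n] into [k] blocks *)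

Section block_index.
Context {k n : nat}.

Lemma block_index_subproof (j : 'I_k) (r : 'I_n) : (j * n + r < k * n)%N.
Proof.
apply: (@leq_trans (j * n + n)); first by rewrite ltn_add2l.
by rewrite addnC -mulSn leq_mul2r ltn_ord orbT.
Qed.

Definition block_index (j : 'I_k) (r : 'I_n) : 'I_(k * n) :=
  Ordinal (block_index_subproof j r).

(** [j] and [r] are the quotient and remainder of [j * n + r] by [n], which gives injectivity; the
    cardinals agree. *)
Lemma block_index_bij : bijective (fun p : 'I_k * 'I_n => block_index p.1 p.2).
Proof.
apply: inj_card_bij; last by rewrite card_prod !card_ord.
move=> [j r] [j' r'] /(congr1 val) /= E.
have n0 : (0 < n)%N := leq_ltn_trans (leq0n r) (ltn_ord r).
have Ej : j = j' :> nat.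
  have := congr1 (fun m => m %/ n)%N E.
  by rewrite !divnMDl// !divn_small// !addn0.
have Er : r = r' :> nat by move/eqP: E; rewrite Ej eqn_add2l => /eqP.
by congr (_, _); exact: val_inj.
Qed.

Lemma big_block_index (V : Type) (idx : V) (op : Monoid.com_law idx)
    (F : 'I_(k * n) -> V) :
  \big[op/idx]_(i < k * n) F i =
  \big[op/idx]_(j < k) \big[op/idx]_(r < n) F (block_index j r).
Proof.
rewrite pair_bigA/= (reindex (fun p : 'I_k * 'I_n => block_index p.1 p.2))//=.
exact/onW_bij/block_index_bij.
Qed.

Lemma concat_blocks {T : Type} :
  exists cat : ('I_k -> n.-tuple T) -> (k * n).-tuple T,
  forall c j r, tnth (cat c) (block_index j r) = tnth (c j) r.
Proof.
have [h hK _] := block_index_bij.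
exists (fun c => [tuple tnth (c (h i).1) (h i).2 | i < k * n]) => c j r.
by rewrite tnth_mktuple (hK (j, r)).
Qed.

Lemma forall_block_index (Pr : 'I_(k * n) -> Prop) :
  (forall j r, Pr (block_index j r)) -> forall i, Pr i.
Proof.
have [h _ hK] := block_index_bij.
by move=> H i; rewrite -(hK i); exact: H.
Qed.

End block_index.

Section subblock.
Context {d : measure_display} {T : measurableType d} {k n : nat}.

Definition subblock (j : 'I_k) (x : (k * n).-tuple T) : n.-tuple T :=
  [tuple tnth x (block_index j r) | r < n].

Lemma measurable_subblock j :
  measurable_fun [set: (k * n).-tuple T] (subblock j).
Proof.
apply/measurable_fun_tnthP => r.
rewrite (_ : _ \o _ = (@tnth (k * n) T)^~ (block_index j r)).
  exact: measurable_tnth.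
by apply/funext => x /=; rewrite tnth_mktuple.
Qed.

HB.instance Definition _ j :=
  isMeasurableFun.Build _ _ _ _ (subblock j) (measurable_subblock j).

End subblock.

(** * From quantizers and codes to bounds on [Rn] *)

Section blocks.
Context {R : realType} {dA dB : measure_display}.
Context {A : measurableType dA} {B : measurableType dB}.
Context (rho : A -> B -> R) (M : B -> R).
Hypothesis rho_ge0 : forall x y, 0 <= rho x y.
Hypothesis rho_meas : measurable_fun [set: A * B] (fun z => rho z.1 z.2).
Hypothesis M_meas : measurable_fun [set: B] M.
Hypothesis M_gt0 : forall y, 0 < M y.

Lemma rhon_ge0 (n : nat) (x : n.-tuple A) (y : n.-tuple B) : 0 <= rhon rho x y.
Proof. by rewrite mulr_ge0 ?invr_ge0 ?sumr_ge0. Qed.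

Lemma Mn_gt0 (n : nat) (y : n.-tuple B) : 0 < Mn M y.
Proof. exact: prodr_gt0. Qed.

Lemma measurable_rhon (n : nat) : measurable_fun
  [set: n.-tuple A * n.-tuple B] (fun z => rhon rho z.1 z.2).
Proof.
apply: measurable_funM => //; apply: measurable_sum => i.
apply: (measurableT_comp (f := fun z : A * B => rho z.1 z.2)
  (g := fun z : n.-tuple A * n.-tuple B => (tnth z.1 i, tnth z.2 i))) => //.
by apply: measurable_fun_pair; apply: (measurableT_comp (measurable_tnth i)).
Qed.

Lemma measurable_rhon_graph (n : nat) (Y : {mfun n.-tuple A >-> n.-tuple B}) :
  measurable_fun [set: n.-tuple A] (fun x => rhon rho x (Y x)).
Proof.
exact: (measurableT_comp (measurable_rhon n) (measurable_graph Y)).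
Qed.

Lemma measurable_Mn (n : nat) :
  measurable_fun [set: n.-tuple B] (@Mn _ _ _ M n).
Proof.
apply: measurable_prod => i _.
exact: (measurableT_comp (f := M) M_meas (measurable_tnth i)).
Qed.

(** The codewords are enumerated injectively by a finite type, so that a product code can be indexed
    by functions into [C]. *)
Lemma Rn_le_finite_range (n : nat) (P : probability (n.-tuple A) R)
  (Y : {mfun n.-tuple A >-> n.-tuple B}) (I : finType)
  (e : I -> n.-tuple B) (g : n.-tuple A -> I) (D : R) :
  injective e -> (forall i, measurable [set e i]) ->
  (forall x, Y x = e (g x)) ->
  (\int[P]_x (rhon rho x (Y x))%:E <= D%:E)%E ->
  (Rn rho M P D <= (ln (\sum_i Mn M (e i)))%:E)%E.
Proof.
move=> e_inj me Yeg distD.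
have mg : forall i, measurable (g @^-1` [set i]).
  exact: (measurable_fibre Y e g e_inj me Yeg).
pose Q : probability (n.-tuple B) R := distribution P Y.
pose W : probability (n.-tuple A * n.-tuple B)%type R :=
  distribution P (graph Y).
(* Both marginals hold by computation; the distortion bound is a change of variables. *)
have WPQ : couplings rho P Q D W.
  split=> //; rewrite ge0_integral_distribution//.
    by apply/measurable_EFinP; exact: measurable_rhon.
  by move=> z; rewrite lee_fin rhon_ge0.
have lnMY : (fun y => (ln (Mn M y))%:E) \o Y =
    (fun x => (ln (Mn M (e (g x))))%:E).
  by apply/funext => x /=; rewrite Yeg.
have intM : (\int[Q]_y (ln (Mn M y))%:E =
    (\sum_i fine (P (g @^-1` [set i])) * ln (Mn M (e i)))%:E)%E.
  rewrite integral_distribution//.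
  - by rewrite lnMY (integral_finite_valued P g mg (fun i => ln (Mn M (e i)))).
  - apply/measurable_EFinP; apply: measurableT_comp; first exact: measurable_ln.
    exact: measurable_Mn.
  - rewrite lnMY.
    exact: (integrable_finite_valued P g mg (fun i => ln (Mn M (e i)))).
(* Each infimum is bounded by its value at the law of the quantizer: first [Q], then [W]. *)
apply: (@le_trans _ _ (In rho P Q D + \int[Q]_y (ln (Mn M y))%:E)%E).
  by apply: ereal_inf_lbound; exists Q.
apply: (@le_trans _ _ (relent W (P \x Q)%E + \int[Q]_y (ln (Mn M y))%:E)%E).
  by apply: leeD => //; apply: ereal_inf_lbound; exists W.
rewrite (relent_graph P Y e g e_inj me Yeg) intM -EFinD lee_fin addrC.
rewrite -sumrB; under eq_bigr do rewrite -mulrBr.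
apply: gibbs => [i|| i].
- exact: fine_ge0.
- exact: sum_finite_valued.
- exact: Mn_gt0.
Qed.

(** Induction on the list: the head is compared with the best codeword of the tail, and the set
    where the head is at least as close is measurable. *)
Lemma measurable_nearest_codeword (n : nat) (y0 : n.-tuple B)
    (s : seq (n.-tuple B)) :
  exists Y : {mfun n.-tuple A >-> n.-tuple B}, forall x,
    Y x \in y0 :: s /\ (rhon rho x (Y x))%:E = rhonC rho (y0 :: s) x.
Proof.
elim: s y0 => [|y1 s IH] y0.
  exists (cst y0) => x; split; first by rewrite mem_head.
  by rewrite /rhonC big_cons big_nil; apply/esym/min_idPl; rewrite leey.
have [Y YP] := IH y1.
pose F x := if rhon rho x y0 <= rhon rho x (Y x) then y0 else Y x.
have mF : measurable_fun [set: n.-tuple A] F.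
  apply: measurable_fun_ifT => //; apply: measurable_fun_ler.
    exact: (measurable_rhon_graph n (cst y0)).
  exact: measurable_rhon_graph.
pose F' : {mfun n.-tuple A >-> n.-tuple B} :=
  HB.pack F (isMeasurableFun.Build _ _ _ _ F mF).
exists F' => x /=.
have [Yin Ymin] := YP x; rewrite /F /rhonC big_cons.
rewrite -/(rhonC rho (y1 :: s) x) -Ymin.
case: ifPn => [le0|]; last rewrite -ltNge => lt0.
  by split; [rewrite mem_head|apply/esym/min_idPl; rewrite lee_fin].
by split; [rewrite inE Yin orbT|apply/esym/min_idPr; rewrite lee_fin ltW].
Qed.

Lemma Rn_le_code (n : nat) (P : probability (n.-tuple A) R)
  (Y : {mfun n.-tuple A >-> n.-tuple B}) (C : {fset (n.-tuple B)}) (D : R) :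
  (forall y : n.-tuple B, measurable [set y]) ->
  (forall x, Y x \in C) ->
  (\int[P]_x (rhon rho x (Y x))%:E <= D%:E)%E ->
  (Rn rho M P D <= (ln (MnC M C))%:E)%E.
Proof.
move=> mB YC distD; rewrite /MnC big_seq_fsetE/=.
apply: (@Rn_le_finite_range n P Y _ _ (fun x => [` YC x]%fset)) => //.
exact: val_inj.
Qed.

(** The distortion of the long word is the average of its block distortions, each of mean [D] since
    every block has law [P]; expanding the [k]-th power of [MnC M C] gives the mass of the product
    code. *)
Lemma Rn_le_product_code (k n : nat) (P : probability (n.-tuple A) R)
  (Pk : probability ((k * n).-tuple A) R)
  (Y : {mfun n.-tuple A >-> n.-tuple B}) (C : {fset (n.-tuple B)}) (D : R) :
  (0 < k)%N -> (forall y : B, measurable [set y]) ->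
  (forall j S, measurable S -> Pk (subblock j @^-1` S) = P S) ->
  (forall x, Y x \in C) ->
  (\int[P]_x (rhon rho x (Y x))%:E = D%:E)%E ->
  (Rn rho M Pk D <= (k%:R * ln (MnC M C))%:E)%E.
Proof.
move=> k0 mB PkP YC distD.
have [cat catE] := @concat_blocks k n B.
pose e (c : {ffun 'I_k -> C}) := cat (fun j => val (c j)).
pose g (x : (k * n).-tuple A) : {ffun 'I_k -> C} :=
  [ffun j => [` YC (subblock j x)]%fset].
have egE x j r : tnth (e (g x)) (block_index j r) = tnth (Y (subblock j x)) r.
  by rewrite catE ffunE.
have e_inj : injective e.
  move=> c c' cc'; apply/ffunP => j; apply/val_inj/eq_from_tnth => r.
  by have := congr1 ((@tnth _ B)^~ (block_index j r)) cc'; rewrite !catE.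
have meg : measurable_fun [set: (k * n).-tuple A] (e \o g).
  apply/measurable_fun_tnthP; apply: forall_block_index => j r.
  rewrite (_ : _ \o _ = (@tnth n B)^~ r \o (Y \o subblock j)).
    by apply: (measurableT_comp (measurable_tnth r)); exact: measurableT_comp.
  by apply/funext => x /=; rewrite egE.
pose Yk : {mfun (k * n).-tuple A >-> (k * n).-tuple B} :=
  HB.pack (e \o g) (isMeasurableFun.Build _ _ _ _ (e \o g) meg).
have -> : k%:R * ln (MnC M C) = ln (\sum_c Mn M (e c)).
  have -> : \sum_c Mn M (e c) = MnC M C ^+ k.
    under eq_bigr do rewrite /Mn big_block_index/=.
    under eq_bigr do under eq_bigr do under eq_bigr do rewrite catE.
    (* A sum over functions of products is a product of sums. *)
    rewrite -(bigA_distr_bigA (fun (j : 'I_k) (y : C) => Mn M (val y)))/=.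
    by rewrite prodr_const card_ord /MnC big_seq_fsetE.
  rewrite lnXn ?mulr_natl//.
  (* The logarithm of the power needs positive mass; the image under [Y] of an arbitrary word is an
     element of [C]. *)
  rewrite /MnC big_seq_fsetE/= (bigD1 [` YC [tuple point | _ < n]]%fset)//=.
  by rewrite ltr_pwDl ?Mn_gt0 ?sumr_ge0// => y _; rewrite ltW ?Mn_gt0.
apply: (@Rn_le_finite_range _ Pk Yk _ e g) => // [i|].
  exact: measurable_tuple_set1.
have mY : measurable_fun [set: n.-tuple A] (fun x => (rhon rho x (Y x))%:E).
  by apply/measurable_EFinP; exact: measurable_rhon_graph.
have distE x : (rhon rho x (Yk x))%:E =
    (\sum_(j < k) (k%:R^-1)%:E *
       (rhon rho (subblock j x) (Y (subblock j x)))%:E)%E.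
  under [in RHS]eq_bigr do rewrite -EFinM.
  rewrite sumEFin /rhon natrM invfM big_block_index/= -mulrA.
  rewrite mulr_sumr mulr_sumr.
  congr EFin; apply: eq_bigr => j _; congr (_ * (_ * _)).
  by apply: eq_bigr => r _; rewrite /= egE tnth_mktuple.
under eq_integral do rewrite distE.
have mYj j : measurable_fun [set: (k * n).-tuple A]
    (fun x => (rhon rho (subblock j x) (Y (subblock j x)))%:E).
  exact: (measurableT_comp mY (measurable_subblock j)).
rewrite ge0_integral_sum//; last 2 first.
- by move=> j; exact: measurable_funeM.
- by move=> j x _; rewrite mule_ge0// lee_fin ?invr_ge0 ?rhon_ge0.
rewrite (eq_bigr (fun=> (k%:R^-1 * D)%:E)) => [|j _]; last first.
  rewrite ge0_integralZl ?lee_fin ?invr_ge0//; last first.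
    by move=> x _; rewrite lee_fin rhon_ge0.
  (* Transport to the law of the [j]-th block, which is [P] by [PkP]. *)
  have := @ge0_integral_distribution _ _ _ _ _ Pk (subblock j) _ mY.
  rewrite /comp => <-; last by move=> x; rewrite lee_fin rhon_ge0.
  rewrite (eq_measure_integral P); last by move=> S mS _; exact: PkP.
  by rewrite distD.
rewrite sumEFin lee_fin sumr_const card_ord.
rewrite -[leLHS]mulr_natl mulrA divff ?mul1r//.
by rewrite pnatr_eq0 -lt0n.
Qed.

End blocks.

(** * The bound for one block, and its limit for a stationary source *)

Theorem theorem3 (R : realType) (dA dB dO : measure_display)
  (A : measurableType dA) (B : measurableType dB)
  (hA : polish_borel R A) (hB : polish_borel R B)
  (O : measurableType dO) (Pr : probability O R)
  (X : nat -> {mfun O >-> A})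
  (rho : A -> B -> R)
  (rho_ge0 : forall x y, 0 <= rho x y)
  (rho_meas : measurable_fun [set: A * B] (fun z => rho z.1 z.2))
  (M : B -> R) (Mstar : R) (Mstar_gt0 : 0 < Mstar)
  (M_meas : measurable_fun [set: B] M)
  (M_ge : forall y, Mstar <= M y)
  (n : nat) (n_ge1 : (1 <= n)%N)
  (C : {fset (n.-tuple B)}) (C_neq0 : C != fset0 :> {fset _})
  (D : R)
  (hD : (\int[distribution Pr (block X 0 n)]_x rhonC rho C x = D%:E)%E) :
  ((ln (MnC M C))%:E >= Rn rho M (distribution Pr (block X 0 n)) D)%E /\
  ((forall m k (S : set (m.-tuple A)), measurable S ->
       distribution Pr (block X 0 m) S = distribution Pr (block X k m) S) ->
   forall l : \bar R,
     ((fun m : nat => (m.+1%:R^-1)%:E *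
        Rn rho M (distribution Pr (block X 0 m.+1)) D) @ \oo --> l)%E ->
     ((ln (MnC M C))%:E >= n%:R%:E * l)%E).
Proof.
have M_gt0 y : 0 < M y := lt_le_trans Mstar_gt0 (M_ge y).
have mB y : measurable [set y] := polish_measurable_set1 R dB B y hB.
have [Y YC distD] : exists2 Y : {mfun n.-tuple A >-> n.-tuple B},
    forall x, Y x \in C &
    (\int[distribution Pr (block X 0 n)]_x (rhon rho x (Y x))%:E = D%:E)%E.
  have [y0 [s Cs]] : exists y0 s, C = y0 :: s :> seq _.
    have [y] := fset0Pn _ C_neq0.
    rewrite -[y \in C]/(y \in (C : seq _)).
    by case: (C : seq _) => // y0 s _; exists y0, s.
  have [Y YP] := measurable_nearest_codeword rho rho_meas n y0 s.
  exists Y => [x|]; first by have [+ _] := YP x; rewrite -Cs.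
  by rewrite -hD; apply: eq_integral => x _; rewrite Cs; have [_ ->] := YP x.
split.
  apply: (Rn_le_code rho M rho_ge0 rho_meas M_meas M_gt0 n _ Y) => // [y|].
    exact: measurable_tuple_set1.
  by rewrite distD.
move=> stat l Rl; set L := ln (MnC M C).
have n0 : (0 : R) < n%:R by rewrite ltr0n.
have RkL k : (Rn rho M (distribution Pr (block X 0 (k.+1 * n))) D <=
    (k.+1%:R * L)%:E)%E.
  apply: (Rn_le_product_code rho M rho_ge0 rho_meas M_meas M_gt0 _ _
    (distribution Pr (block X 0 n)) _ Y) => //.
  move=> j S mS.
  (* The [j]-th block of the long word is the process shifted by [j * n]; stationarity gives it the
     law of the first block. *)
  transitivity (distribution Pr (block X (j * n) n) S); last exact/esym/stat.
  congr (Pr _); apply/funext => w; rewrite /preimage/=; congr (S _).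
  by apply: eq_from_tnth => r; rewrite !tnth_mktuple.
(* The sequence of rates has word length [m.+1] at index [m], so length [k.+1 * n] sits at the
   predecessor. This subsequence still tends to [l]. *)
pose sub k := (k.+1 * n).-1.
have subE k : (sub k).+1 = (k.+1 * n)%N by rewrite prednK// muln_gt0.
have sub_oo : sub @ \oo --> \oo.
  apply/cvgnyPge => N; near=> k.
  rewrite -ltnS subE (@leq_trans k.+1)//; last by rewrite leq_pmulr.
  by rewrite ltnS; near: k; exact: nbhs_infty_ge.
have : (l <= (n%:R^-1 * L)%:E)%E.
  apply: (cvge_to_le (cvg_comp _ _ sub_oo Rl)).
  apply: nearW => k /=; rewrite subE.
  apply: (@le_trans _ _ (((k.+1 * n)%:R^-1)%:E * (k.+1%:R * L)%:E)%E).
    by rewrite lee_pmul2l// lte_fin invr_gt0 ltr0n muln_gt0.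
  rewrite -EFinM lee_fin natrM invfM mulrACA mulrA.
  by rewrite mulVf ?pnatr_eq0// mul1r.
move=> lL; rewrite -[L](mulKf (lt0r_neq0 n0)) mulrCA EFinM.
by rewrite lee_pmul2l ?lte_fin.
Unshelve. all: by end_near. Qed.
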